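(* For any gradually fragmented ideal $\mathscr I$ on $\omega$, $\operatorname{add}^*_\omega(\mathscr I)\ge\operatorname{add}_t(\mathcal N)$.
   Context: Ideals on $\omega$ are assumed proper ($\omega\notin\mathscr I$) and to contain all finite subsets of $\omega$. A submeasure on a set $P$ is a function $\varphi\colon\mathcal P(P)\to[0,\infty]$ with $\varphi(\emptyset)=0$, monotone under inclusion, and $\varphi(A\cup B)\le\varphi(A)+\varphi(B)$. An ideal $\mathscr I$ on $\omega$ is fragmented if there are a partition $\langle P_n\rangle_{n<\omega}$ of $\omega$ into nonempty finite sets and submeasures $\varphi_n$ on $P_n$ such that for all $X\subseteq\omega$: $X\in\mathscr I\iff\sup_{n<\omega}\varphi_n(X\cap P_n)<\infty$. It is gradually fragmented if moreover (for such $\langle P_n,\varphi_n\rangle_{n<\omega}$) there is $f\colon\omega\to\omega$ such that for all $n<\omega$: for all $i<\omega$, for all but finitely many $j<\omega$, for every family $\overline B$ of at most $i$ subsets of $P_j$, if $\varphi_j(B)\le n$ for all $B\in\overline B$ then $\varphi_j(\bigcup\overline B)\le f(n)$. $\operatorname{add}^*_\omega(\mathscr I)=\min\{|\mathcal A|:\mathcal A\subseteq\mathscr I,\ \forall\overline B\in[\mathscr I]^\omega\,\exists A\in\mathcal A\,\forall B\in\overline B\ A\not\subseteq^*B\}$, where $[\mathscr I]^\omega$ is the set of countably infinite subsets of $\mathscr I$ and $\subseteq^*$ is inclusion modulo finite; it is set to be $\infty$ if no such $\mathcal A$ exists. $\mathcal N$ is the null ideal on $2^\omega$, where $2^\omega$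 is regarded as a group under coordinatewise addition modulo 2, and $\operatorname{add}_t(\mathcal N)=\min\{|A|:A\subseteq2^\omega,\ \exists X\in\mathcal N\ A+X\notin\mathcal N\}$ (transitive additivity). *)

(* Defs.v *)
From mathcomp Require Import all_boot all_order all_algebra.
From mathcomp Require Import all_classical all_reals all_analysis.
Set Implicit Arguments.
Unset Strict Implicit.
Unset Printing Implicit Defensive.
Import Order.TTheory GRing.Theory Num.Theory.
Local Open Scope classical_set_scope.
Local Open Scope ring_scope.

(* A cardinal invariant min {|A| : A in W} is represented by a member of W of
   least cardinality, or by None (standing for infinity) when W is empty. *)

Definition least_card T (W : set (set T)) (C : set T) :=
  W C /\ forall D, W D -> (C #<= D)%card.

Definition min_card T (W : set (set T)) : option (set T) :=
  if pselect (exists C, least_card W C) is left h then Some (sval (cid h))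
  else None.

Definition cardinal_le T U (a : option (set T)) (b : option (set U)) : Prop :=
  match a, b with
  | _, None => True
  | None, Some _ => False
  | Some A, Some B => (A #<= B)%card
  end.

(* Cardinals are well-founded, hence min_card W is None only if W is empty. *)
Lemma least_card_ex T (W : set (set T)) :
  W !=set0 -> exists C, least_card W C.
Proof.
move=> [D1 WD1].
pose P (R : set (set T -> T)) :=
  (forall f D, R f -> W D -> D (f D)) /\
  (forall f g D, R f -> R g -> W D -> f D = g D -> f = g).
have chainP (F : set (set (set T -> T))) : F `<=` P ->
    total_on F subset -> P (\bigcup_(X in F) X).
  move=> FP tot; split=> [f D [X FX Xf]|f g D [X FX Xf] [Y FY Yg]].
    exact: (FP _ FX).1.
  by have [XY|YX] := tot _ _ FX FY; [apply: (FP _ FY).2|apply: (FP _ FX).2];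
    auto.
have [R [[Rsel Rinj] Rmax]] := Zorn_bigcup chainP.
have [[D [WD DR]]|noD] :=
    pselect (exists D, W D /\ D `<=` [set f D | f in R]).
  exists D; split=> // E WE.
  apply: card_le_trans (subset_card_le DR) _.
  apply: card_le_trans (card_image_le (fun f : set T -> T => f D) R) _.
  have imE : [set f E | f in R] `<=` E.
    by move=> _ [f Rf <-]; exact: (Rsel f E Rf WE).
  apply: card_le_trans (subset_card_le imE).
  have /card_eqPle[] // : ([set f E | f in R] #= R)%card.
  apply: (@inj_card_eq _ _ R (fun f : set T -> T => f E)).
  move=> f g /set_mem Rf /set_mem Rg; exact: Rinj Rf Rg WE.
have newx D : W D -> exists x, D x /\ forall f, R f -> f D <> x.
  move=> WD; apply: contrapT => nx; apply: noD; exists D; split=> // x Dx.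
  apply: contrapT => nRx; apply: nx; exists x; split=> // f Rf fx.
  by apply: nRx; exists f.
have [x0 _] := newx _ WD1.
have gP D : exists x, W D -> D x /\ forall f, R f -> f D <> x.
  have [/newx[x xP]|nWD] := pselect (W D); first by exists x.
  by exists x0.
have {gP}[g gP] := choice gP.
exfalso; apply: (Rmax (R `|` [set g])).
  split; first exact: subsetUl.
  move=> sub; have Rg : R g by apply: sub; right.
  by have [_ /(_ _ Rg)] := gP _ WD1.
split=> [f D [Rf|->] WD|f h D [Rf|->] [Rh|->] WD //].
- exact: (Rsel f D Rf WD).
- by have [] := gP _ WD.
- exact: Rinj WD.
- by move=> e; have [_ /(_ _ Rf)] := gP _ WD.
- by move=> e; have [_ /(_ _ Rh)] := gP _ WD; rewrite e.
Qed.

Lemma cardinal_le_minP T U (V : set (set T)) (W : set (set U)) :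
  cardinal_le (min_card V) (min_card W) <->
  forall D, W D -> exists2 C, V C & (C #<= D)%card.
Proof.
rewrite /min_card; case: pselect => [hV|nV]; case: pselect => [hW|nW] /=.
- case: (cid hV) => C [VC Cmin]; case: (cid hW) => E [WE Emin] /=.
  split=> [CE D WD|/(_ _ WE)[C' VC' C'E]].
    by exists C => //; exact: card_le_trans (Emin _ WD).
  exact: card_le_trans (Cmin _ VC') C'E.
- by split=> // _ D WD; exfalso; apply: nW; apply: least_card_ex; exists D.
- split=> // H; case: hW => E [WE _]; have [C VC _] := H _ WE.
  by apply: nV; apply: least_card_ex; exists C.
- by split=> // _ D WD; exfalso; apply: nW; apply: least_card_ex; exists D.
Qed.

Record omega_ideal (I : set (set nat)) : Prop := OmegaIdeal {
  ideal_sub : forall A B, A `<=` B -> I B -> I A;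
  ideal_union : forall A B, I A -> I B -> I (A `|` B);
  ideal_fin : forall A, finite_set A -> I A;
  ideal_proper : ~ I setT
}.

(* Only the values of phi on subsets of P are constrained. *)
Record submeasure_on (R : realType) (T : Type) (P : set T)
    (phi : set T -> \bar R) : Prop := SubmeasureOn {
  submeasure_ge0 : forall A, A `<=` P -> (0 <= phi A)%E;
  submeasure0 : phi set0 = 0%E;
  submeasure_mono : forall A B, A `<=` B -> B `<=` P -> (phi A <= phi B)%E;
  submeasure_subadd : forall A B, A `<=` P -> B `<=` P ->
    (phi (A `|` B) <= phi A + phi B)%E
}.

Record fragmentation (R : realType) (I : set (set nat))
    (P : nat -> set nat) (phi : nat -> set nat -> \bar R) : Prop :=
  Fragmentation {
  frag_partition : partition setT P setT;
  frag_finite : forall n, finite_set (P n);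
  frag_submeasure : forall n, submeasure_on (P n) (phi n);
  frag_idealE : forall X, I X <->
    (ereal_sup (range (fun n => phi n (X `&` P n))) < +oo)%E
}.

Definition gradual (R : realType)
    (P : nat -> set nat) (phi : nat -> set nat -> \bar R) : Prop :=
  exists f : nat -> nat, forall n i : nat, \forall j \near \oo,
    forall BB : set (set nat),
      (forall B, BB B -> B `<=` P j) -> (BB #<= `I_i)%card ->
      (forall B, BB B -> (phi j B <= n%:R%:E)%E) ->
      (phi j (\bigcup_(B in BB) B) <= (f n)%:R%:E)%E.

Definition gradually_fragmented (R : realType) (I : set (set nat)) : Prop :=
  exists (P : nat -> set nat) (phi : nat -> set nat -> \bar R),
    fragmentation I P phi /\ gradual P phi.

Definition almost_subset (A B : set nat) : Prop := finite_set (A `\` B).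

Definition add_star_omega (I : set (set nat)) : option (set (set nat)) :=
  min_card [set AA : set (set nat) | AA `<=` I /\
    forall BB : set (set nat), BB `<=` I -> (BB #= [set: nat])%card ->
      exists2 A, AA A & forall B, BB B -> ~ almost_subset A B].

Definition cylinder (s : seq bool) : set (nat -> bool) :=
  [set x | forall k, (k < size s)%N -> x k = nth false s k].

(* The outer measure of the product (coin-tossing) measure on 2^omega, under
   which the cylinder of s has measure 2^-|s|. *)
Definition coin_outer (R : realType) (X : set (nat -> bool)) : \bar R :=
  ereal_inf [set (\sum_(0 <= k <oo) ((2^-1 : R) ^+ size (s k))%:E)%E |
    s in [set s : nat -> seq bool | X `<=` \bigcup_k cylinder (s k)]].

Definition null_set (R : realType) : set (set (nat -> bool)) :=
  [set X | coin_outer R X = 0%E].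

Definition cantor_add (x y : nat -> bool) : nat -> bool :=
  fun n => x n (+) y n.

Definition cantor_sumset (A X : set (nat -> bool)) : set (nat -> bool) :=
  [set cantor_add a x | a in A & x in X].

Definition add_t_null (R : realType) : option (set (nat -> bool)) :=
  min_card [set A : set (nat -> bool) |
    exists2 X, null_set R X & ~ null_set R (cantor_sumset A X)].

(* Main.v *)
Require Import Defs.
From HB Require Import structures.
From mathcomp Require Import all_boot all_order all_algebra.
From mathcomp Require Import all_classical all_reals all_analysis.
From mathcomp Require Import zify ring lra.
Set Implicit Arguments.
Unset Strict Implicit.
Unset Printing Implicit Defensive.
Import Order.TTheory GRing.Theory Num.Theory.
Local Open Scope classical_set_scope.
Local Open Scope ring_scope.

(* A family AA in I with fewer than add_t(N) members splits into countably many
   pieces, according to an integer bound m on sup_n phi_n (A `&` P_n).  Group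
   the fragments into blocks, slowly enough that, by gradualness, a union of
   2^(k+1) sets of submeasure at most m inside a fragment of block k has
   submeasure at most f m.  It then suffices to predict the trace of A on almost
   every block k by one of 2^(k+1) candidates, using countably many predictors.

   Traces on block k are coded by translations of 2^(L_k), with a set J_k of
   measure at most 2^-(k+1) such that any 2^(k+1) translates of J_k cover at
   least half of 2^(L_k).  The set X of the reals lying in J_k for infinitely
   many k is null, so by assumption the translates of X by the codes of AA are
   covered by an open set U whose complement K is not null.  A Baire category
   argument in K gives, for each A, a basic clopen set t such that K `&` t is
   not null and, for almost all k, the translate of J_k by the code of A meets
   K `&` t in a null set.  For almost all k at most 2^(k+1) translates of J_k
   can do so, since otherwise the measure of K `&` t would be halved infinitely
   often. *)

(** * The coin-tossing outer measure *)

Definition cyl_weight (R : realType) (s : seq bool) : \bar R :=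
  ((2^-1 : R) ^+ size s)%:E.

Lemma cyl_weight_ge0 (R : realType) (s : seq bool) : (0 <= cyl_weight R s)%E.
Proof. by rewrite lee_fin exprn_ge0. Qed.

Lemma cyl_weight_small (R : realType) (e : R) : 0 < e ->
  exists n, 2^-1 ^+ n < e.
Proof.
move=> e0; have [n _ /(_ n (leqnn n))] :=
  near_infty_natSinv_expn_lt (PosNum e0).
by rewrite /= div1r -exprVn => h; exists n.
Qed.

Lemma coin_outer_ge0 (R : realType) (X : set (nat -> bool)) :
  (0 <= coin_outer R X)%E.
Proof.
apply: le_ereal_inf_tmp => _ [s _ <-]; apply: nneseries_ge0 => k _ _.
exact: cyl_weight_ge0.
Qed.

Lemma coin_outer_le_cover (R : realType) (X : set (nat -> bool)) s :
  X `<=` \bigcup_k cylinder (s k) ->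
  (coin_outer R X <= \sum_(k <oo) cyl_weight R (s k))%E.
Proof. by move=> Xs; apply: ereal_inf_lbound; exists s. Qed.

Lemma le_coin_outer (R : realType) :
  {homo coin_outer R : A B / A `<=` B >-> (A <= B)%E}.
Proof.
move=> A B AB; apply: ereal_inf_le_tmp => _ [s Bs <-]; exists s => //.
exact: subset_trans Bs.
Qed.

Lemma coin_outer_cylinder (R : realType) (s : seq bool) :
  (coin_outer R (cylinder s) <= cyl_weight R s)%E.
Proof.
apply/lee_addgt0Pr => e e0; have [N Ne] := cyl_weight_small e0.
(* Covers are infinite sequences and no string has weight zero, so [s] is padded with cylinders of
   total weight [2^-N]. *)
pose u k := if k is k'.+1 then nseq (N + k'.+1) false else s.
apply: le_trans (@coin_outer_le_cover R _ u _) _.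
  by move=> x sx; exists 0%N.
rewrite nneseries_recl//; last by move=> *; exact: cyl_weight_ge0.
rewrite leeD2l// -nneseries_addn; last by move=> *; exact: cyl_weight_ge0.
apply: (@le_trans _ _ (2^-1 ^+ N)%:E); last by rewrite lee_fin ltW.
apply: le_trans (@epsilon_trick0 R (2^-1 ^+ N) xpredT _); last exact: exprn_ge0.
apply: lee_nneseries => k _; first by move=> _; exact: cyl_weight_ge0.
by rewrite /u addn1 /cyl_weight size_nseq exprD natrX -exprVn.
Qed.

Lemma coin_outer_set0 (R : realType) : coin_outer R set0 = 0%E.
Proof.
apply/eqP; rewrite eq_le coin_outer_ge0 andbT; apply/lee_addgt0Pr => e e0.
have [N Ne] := cyl_weight_small e0.
apply: (le_trans (@le_coin_outer R _ (cylinder (nseq N false)) (@sub0set _ _))).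
apply: le_trans (coin_outer_cylinder _ _) _.
by rewrite add0e lee_fin size_nseq ltW.
Qed.

Lemma coin_outer_near (R : realType) (X : set (nat -> bool)) (e : R) : 0 < e ->
  exists2 s, X `<=` \bigcup_k cylinder (s k) &
    (\sum_(k <oo) cyl_weight R (s k) <= coin_outer R X + e%:E)%E.
Proof.
move=> e0; have [Xoo|Xfin] := eqVneq (coin_outer R X) +oo%E.
  exists (fun=> [::]); first by move=> x _; exists 0%N.
  by rewrite Xoo addye// leey.
have Xf : coin_outer R X \is a fin_num.
  by rewrite ge0_fin_numE ?coin_outer_ge0// ltey.
have [_ [s Xs <-] /ltW sX] := lb_ereal_inf_adherent e0 Xf.
by exists s.
Qed.

Lemma coin_outer_sigma_subadditive (R : realType) :
  sigma_subadditive (coin_outer R).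
Proof.
move=> A; apply/lee_addgt0Pr => e e0.
rewrite (le_trans _
  (epsilon_trick _ (fun n => coin_outer_ge0 _ (A n)) (ltW e0)))//.
have [G PG] : {G : nat -> nat -> seq bool & forall n,
    A n `<=` \bigcup_k cylinder (G n k) /\
    (\sum_(k <oo) cyl_weight R (G n k) <=
     coin_outer R (A n) + (e / (2 ^ n.+1)%:R)%:E)%E}.
  apply: (@choice _ _ (fun n s => A n `<=` \bigcup_k cylinder (s k) /\
    (\sum_(k <oo) cyl_weight R (s k) <=
     coin_outer R (A n) + (e / (2 ^ n.+1)%:R)%:E)%E)) => n.
  have en : 0 < e / (2 ^ n.+1)%:R by rewrite divr_gt0// ltr0n expn_gt0.
  by have [s] := coin_outer_near (A n) en; exists s.
(* A bijection between [nat] and pairs merges the covers of all the [A n] into one sequence. *)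
have /card_esym/ppcard_eqP[f] := card_nat2.
apply: (@le_trans _ _ (\sum_(k <oo) cyl_weight R (G (f k).1 (f k).2))%E).
  apply: coin_outer_le_cover => x [i _ /(PG i).1 [j _ Gx]].
  by exists (f^-1%FUN (i, j)) => //=; rewrite invK ?inE.
rewrite nneseries_esumT; last by move=> *; exact: cyl_weight_ge0.
rewrite -(@reindex_esum R _ _ setT setT f (fun p => cyl_weight R (G p.1 p.2)));
  last exact: bij.
rewrite (_ : [set: nat * nat] = setT `*`` (fun=> setT)); last first.
  by apply/seteqP; split=> //.
rewrite -(@esum_esum _ _ _ setT (fun=> setT) (fun i j => cyl_weight R (G i j)));
  last by move=> *; exact: cyl_weight_ge0.
rewrite -nneseries_esumT; last first.
  by move=> n; apply: esum_ge0 => *; exact: cyl_weight_ge0.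
apply: lee_nneseries => n _.
  by move=> _; apply: esum_ge0 => *; exact: cyl_weight_ge0.
rewrite -nneseries_esumT; last by move=> *; exact: cyl_weight_ge0.
exact: (PG n).2.
Qed.

HB.instance Definition _ (R : realType) :=
  isOuterMeasure.Build R (nat -> bool) (coin_outer R) (coin_outer_set0 R)
    (@coin_outer_ge0 R) (@le_coin_outer R) (@coin_outer_sigma_subadditive R).

Lemma coin_outer_bigcup_fin (R : realType) (I : finType)
    (F : I -> set (nat -> bool)) (X : set (nat -> bool)) :
  X `<=` \bigcup_i F i ->
  (coin_outer R X <= \sum_i coin_outer R (F i))%E.
Proof.
move=> XF; apply: (@le_trans _ _ (coin_outer R (\big[setU/set0]_i F i))).
  apply: le_coin_outer => x /XF[i _ Fx]; rewrite (bigD1 i)//=; by left.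
apply: (big_ind2 (fun A x => coin_outer R A <= x)%E) => //.
  by rewrite coin_outer_set0.
move=> A x B y Ax By; apply: le_trans (outer_measureU2 _ A B) _.
exact: leeD.
Qed.

(** * Counting translates in a finite cube *)

Lemma card_ffun_point (P V : finType) (p : P) (v : V) :
  (#|[set w : {ffun P -> V} | w p == v]%SET| * #|V| = #|V| ^ #|P|)%N.
Proof.
pose F x := if x == p then pred1 v else predT.
have -> : #|[set w : {ffun P -> V} | w p == v]%SET| =
    #|(family F : pred {ffun P -> V})|.
  apply: eq_card => w; rewrite inE; apply/eqP/familyP => [wp x|/(_ p)].
    by rewrite /F; case: eqP => [->|]; rewrite inE ?wp ?eqxx.
  by rewrite /F eqxx inE => /eqP.
rewrite card_family foldrE big_image (bigD1 p)//= /F eqxx card1 mul1n.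
rewrite (eq_bigr (fun=> #|V|)); last by move=> i /negPf ->; exact: eq_card.
rewrite prod_nat_const mulnC -expnS cardC1 prednK//.
by apply/card_gt0P; exists p.
Qed.

(** Double counting: for each [v] and each [p] in [A v], the tables [w] with [w p = v] make up a
    fraction [1 / #|V|] of all tables. *)
Lemma card_graph_in (P V : finType) (A : V -> {set P}) :
  (#|[set pw : P * {ffun P -> V} | pw.1 \in A (pw.2 pw.1)]%SET| * #|V| =
   (\sum_v #|A v|) * #|V| ^ #|P|)%N.
Proof.
rewrite -sum1dep_card.
rewrite -(pair_big_dep xpredT (fun p (w : {ffun P -> V}) => p \in A (w p))
  (fun _ _ => 1%N)) /=.
under eq_bigr => p _.
  rewrite (partition_big (fun w : {ffun P -> V} => w p)
    (fun v => p \in A v))//=.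
  under eq_bigr => v pAv.
    rewrite (eq_bigl (fun w : {ffun P -> V} => w p == v)); last first.
      by move=> w; case: eqP => [->|]; rewrite ?pAv ?andbF.
    rewrite sum1dep_card; over.
  over.
rewrite (exchange_big_dep xpredT)//= big_distrl/= big_distrl/=.
apply: eq_bigr => v _; rewrite big_distrl/= -sum_nat_const.
by apply: eq_bigr => p _; rewrite card_ffun_point.
Qed.

Lemma card_ffun_avoid (Q V : finType) (S : {set Q}) (v : V) :
  #|[set p : {ffun Q -> V} | [forall q in S, p q != v]]%SET| =
  (#|V|.-1 ^ #|S| * #|V| ^ (#|Q| - #|S|))%N.
Proof.
pose F q := if q \in S then predC1 v else predT.
have -> : #|[set p : {ffun Q -> V} | [forall q in S, p q != v]]%SET| =
    #|(family F : pred {ffun Q -> V})|.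
  apply: eq_card => w; rewrite inE; apply/forall_inP/familyP => [wS q|wF q qS].
    by rewrite /F; case: ifP => // /wS; rewrite inE.
  by have := wF q; rewrite /F qS inE.
rewrite card_family foldrE big_image (bigID (mem S))/=.
rewrite (eq_bigr (fun=> #|V|.-1)); last by move=> q qS; rewrite /F qS cardC1.
rewrite [X in (_ * X)%N](eq_bigr (fun=> #|V|)); last first.
  by move=> q /negPf qS; rewrite /F qS; exact: eq_card.
by rewrite !prod_nat_const -(cardC (mem S)) addKn.
Qed.

(** Bernoulli's inequality. With [M = 2 ^ K] it says that [2 ^ K] or more independent events of
    probability [2^-K] all fail with probability at most 1/2. *)
Lemma double_pred_expn (M n : nat) : (0 < M)%N -> (M <= n)%N ->
  (M.-1 ^ n * 2 <= M ^ n)%N.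
Proof.
case: M => // M _ Mn /=.
have bern k : (M ^ k.+1 + k.+1 * M ^ k <= M.+1 ^ k.+1)%N.
  elim: k => [|k IH]; first by rewrite !expn1 expn0 muln1 addn1.
  rewrite [leqRHS]expnS; apply: leq_trans (leq_mul (leqnn _) IH).
  by rewrite !expnS; nia.
case: n Mn => // n Mn; apply: leq_trans (bern n).
by rewrite muln2 -addnn leq_add2l expnS leq_mul// ltnW.
Qed.

Definition xor_tuple n (z u : n.-tuple bool) : n.-tuple bool :=
  [tuple tnth z i (+) tnth u i | i < n].

(* Read a bit string as a pair of tables [p : Q -> V] and [w : (Q -> V) -> V],
   where [V] has [2^K] elements.  [J] says [w p = 0] and [e q] translates [w] by
   the evaluation [p |-> p q], so that the translate of [J] by [e q] says
   [w p = p q]: once the value [w p] is known, these events are independent. *)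
Lemma independent_translates (Q : finType) (K : nat) :
  exists (L : nat) (e : Q -> L.-tuple bool) (J : {set L.-tuple bool}),
    [/\ (K <= L)%N, (#|J| * 2 ^ K <= 2 ^ L)%N &
    forall S : {set Q}, (2 ^ K <= #|S|)%N ->
      (#|[set z | [forall q in S, xor_tuple z (e q) \notin J]]%SET| * 2
       <= 2 ^ L)%N].
Proof.
pose V := {ffun 'I_K -> bool}; pose P := {ffun Q -> V}.
pose I : finType := ((Q * 'I_K) + (P * 'I_K))%type.
pose L := #|{: I}|.
pose dec (z : L.-tuple bool) : P * {ffun P -> V} :=
  ([ffun q => [ffun i => tnth z (enum_rank (inl (q, i) : I))]],
   [ffun p => [ffun i => tnth z (enum_rank (inr (p, i) : I))]]).
have dec_inj : injective dec.
  move=> z z' /pair_equal_spec[/ffunP h1 /ffunP h2]; apply: eq_from_tnth => i.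
  rewrite -(enum_valK i); case: (enum_val i) => -[x j].
    by have := h1 x; rewrite !ffunE => /ffunP/(_ j); rewrite !ffunE.
  by have := h2 x; rewrite !ffunE => /ffunP/(_ j); rewrite !ffunE.
pose e (q : Q) : L.-tuple bool := [tuple
  match enum_val i with inl _ => false | inr pj => pj.1 q pj.2 end | i < L].
pose v0 : V := [ffun=> false].
pose J := [set z | (dec z).2 (dec z).1 == v0]%SET.
have cardV : #|V| = (2 ^ K)%N by rewrite card_ffun card_bool card_ord.
have cardL : (2 ^ L = #|P| * #|V| ^ #|P|)%N.
  have cardP : #|P| = (2 ^ (K * #|Q|))%N by rewrite card_ffun cardV expnM.
  rewrite cardV -expnM cardP -expnD /L card_sum !card_prod card_ord cardP.
  by congr expn; rewrite mulnC; congr addn; rewrite mulnC.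
have card_dec (G : {set P * {ffun P -> V}}) :
    (#|[set z | dec z \in G]%SET| <= #|G|)%N.
  rewrite -(card_imset _ dec_inj); apply: subset_leq_card.
  by apply/fintype.subsetP => _ /imsetP[z + ->]; rewrite inE.
have V0 : (0 < #|V|)%N by rewrite cardV expn_gt0.
exists L, e, J; split.
- rewrite /L card_sum !card_prod card_ord (leq_trans _ (leq_addl _ _))//.
  by rewrite leq_pmull// card_ffun expn_gt0 V0.
- rewrite -cardV cardL.
  pose A v : {set P} := if v == v0 then [set: P]%SET else finset.set0.
  apply: (@leq_trans
      (#|[set pw : P * {ffun P -> V} | pw.1 \in A (pw.2 pw.1)]%SET| * #|V|)).
    rewrite leq_mul2r; apply/orP; right; apply: leq_trans (card_dec _).
    apply: subset_leq_card; apply/fintype.subsetP => z.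
    by rewrite !inE => /eqP zv; rewrite /A zv eqxx inE.
  rewrite card_graph_in leq_mul2r; apply/orP; right.
  rewrite (bigD1 v0)//= big1 ?addn0; first by rewrite /A eqxx cardsT.
  by move=> v /negPf vv; rewrite /A vv cards0.
- move=> S; rewrite -cardV => VS.
  (* Translation by [e q] keeps the table [p] and adds [p q] to each entry [w p]. *)
  have decX z q :
      (xor_tuple z (e q) \in J) = ((dec z).2 (dec z).1 == (dec z).1 q).
    have d1 : (dec (xor_tuple z (e q))).1 = (dec z).1.
      apply/ffunP => r; rewrite !ffunE; apply/ffunP => i; rewrite !ffunE.
      by rewrite !tnth_mktuple enum_rankK addbF.
    have d2 p i : (dec (xor_tuple z (e q))).2 p i = (dec z).2 p i (+) p q i.
      by rewrite /dec/= !ffunE !tnth_mktuple enum_rankK.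
    rewrite inE d1; move: (dec z).1 => p.
    apply/eqP/eqP => [/ffunP h|h]; apply/ffunP => i.
      by apply/eqP; rewrite -[_ == _]negbK negb_eqb -d2 h ffunE.
    by rewrite d2 h addbb ffunE.
  (* The string [z] avoids all translates indexed by [S] exactly when its table [p] never takes the
     value [v = w p] on [S]. *)
  pose A v : {set P} := [set p : P | [forall q in S, p q != v]]%SET.
  rewrite -(leq_pmul2r V0) mulnAC.
  apply: (@leq_trans (#|[set pw : P * {ffun P -> V} |
      pw.1 \in A (pw.2 pw.1)]%SET| * #|V| * 2)).
    rewrite !leq_mul2r; do 2 (apply/orP; right).
    apply: leq_trans (card_dec _); apply: subset_leq_card.
    apply/fintype.subsetP => z; rewrite !inE => /forall_inP zS.
    by apply/forall_inP => q /zS; rewrite decX eq_sym.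
  rewrite card_graph_in cardL.
  rewrite (eq_bigr
    (fun=> (#|V|.-1 ^ #|S| * #|V| ^ (#|Q| - #|S|))%N)); last first.
    by move=> v _; rewrite card_ffun_avoid.
  rewrite sum_nat_const.
  have SQ : (#|S| <= #|Q|)%N by exact: max_card.
  have -> : #|P| = (#|V| ^ #|S| * #|V| ^ (#|Q| - #|S|))%N.
    by rewrite -expnD subnKC// card_ffun.
  rewrite -[#|xpredT|]/#|V|; have := double_pred_expn V0 VS.
  set b := (#|V| ^ (#|Q| - #|S|))%N; set d := (#|V| ^ #|S|)%N.
  set c := (#|V|.-1 ^ #|S|)%N; set a := (#|V| ^ (d * b))%N => cd.
  have -> : (#|V| * (c * b) * a * 2 = c * 2 * (#|V| * b * a))%N by lia.
  have -> : (d * b * a * #|V| = d * (#|V| * b * a))%N by lia.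
  by rewrite leq_mul2r cd orbT.
Qed.

(** * Outer measure inside cylinders *)

Lemma cylinderP (s : seq bool) (x : nat -> bool) :
  cylinder s x <-> mkseq x (size s) = s.
Proof.
split=> [xs|<- k]; last by rewrite size_mkseq => ks; rewrite nth_mkseq.
apply: (@eq_from_nth _ false) => [|k]; rewrite size_mkseq// => ks.
by rewrite nth_mkseq// xs.
Qed.

Lemma mkseq_addn (T : Type) (x : nat -> T) (m n : nat) :
  mkseq x (m + n) = mkseq x m ++ mkseq (fun i => x (m + i)%N) n.
Proof.
by rewrite /mkseq iotaD map_cat add0n -[in iota m n](addn0 m) iotaDl -map_comp.
Qed.

Lemma coin_outer_split (R : realType) (X : set (nat -> bool)) t n :
  (coin_outer R (X `&` cylinder t) <=
   \sum_(z : n.-tuple bool) coin_outer R (X `&` cylinder (t ++ z)))%E.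
Proof.
apply: coin_outer_bigcup_fin => x [Xx /cylinderP tx].
exists [tuple of mkseq (fun i => x (size t + i)%N) n] => //; split => //.
apply/cylinderP; set z := tval _.
by rewrite (_ : size _ = size t + n)%N ?mkseq_addn ?tx// size_cat size_tuple.
Qed.

(** Finite subadditivity over the cylinders of length [a + L]. With [r = 1] it bounds the measure of
    a condition on one block; with [d = 1/2] it halves an earlier bound. *)
Lemma coin_outer_block (R : realType) (X : set (nat -> bool)) t (a L : nat)
    (G : {set L.-tuple bool}) (r d : R) :
  (size t <= a)%N -> 0 <= r -> (#|G|%:R <= d * 2 ^+ L) ->
  (forall v, size v = a -> prefix t v -> forall z : L.-tuple bool,
    (coin_outer R (X `&` cylinder (v ++ z)) <=
     if z \in G then (r * 2^-1 ^+ (a + L))%:E else 0)%E) ->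
  (coin_outer R (X `&` cylinder t) <= (r * d * 2^-1 ^+ size t)%:E)%E.
Proof.
move=> ta r0 GL XG; apply: le_trans (coin_outer_split R X t (a - size t)) _.
apply: (@le_trans _ _
    (\sum_(v : (a - size t).-tuple bool) (r * d * 2^-1 ^+ a)%:E)%E).
  apply: lee_sum => v _; apply: le_trans (coin_outer_split R X (t ++ v) L) _.
  apply: (@le_trans _ _ (\sum_(z : L.-tuple bool)
      if z \in G then (r * 2^-1 ^+ (a + L))%:E else 0)%E).
    apply: lee_sum => z _; apply: XG.
      by rewrite size_cat size_tuple subnKC.
    exact: prefix_prefix.
  rewrite -big_mkcond sumEFin lee_fin sumr_const exprD -[_ *+ #|_|]mulr_natl.
  have -> : #|G|%:R * (r * (2^-1 ^+ a * 2^-1 ^+ L)) =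
      (r * 2^-1 ^+ a) * (#|G|%:R / 2 ^+ L) :> R by rewrite -exprVn; ring.
  have -> : r * d * 2^-1 ^+ a = r * 2^-1 ^+ a * d by ring.
  rewrite ler_wpM2l ?mulr_ge0 ?exprn_ge0//.
  by rewrite ler_pdivrMr ?exprn_gt0.
rewrite sumEFin lee_fin sumr_const -[_ *+ #|_|]mulr_natl.
rewrite card_tuple card_bool natrX.
rewrite -{2}(subnKC ta) exprD.
have e2 : 2 ^+ (a - size t) * 2^-1 ^+ (a - size t) = 1 :> R.
  by rewrite -exprMn mulfV ?expr1n// pnatr_eq0.
rewrite [leLHS](_ : _ = r * d * 2^-1 ^+ size t *
  (2 ^+ (a - size t) * 2^-1 ^+ (a - size t))); last by ring.
by rewrite e2 mulr1.
Qed.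

Lemma coin_outer_setT (R : realType) : (1 <= coin_outer R setT)%E.
Proof.
apply: le_ereal_inf_tmp => _ [s sT <-]; rewrite leNgt; apply/negP => s1.
(* Follow a branch [t] along which the cylinders of the cover inside [t] have
   total weight less than [2^-|t|]: it avoids every cylinder of the cover. *)
pose f t k := if prefix t (s k) then cyl_weight R (s k) else 0%E.
pose w t := (\sum_(k <oo) f t k)%E.
have f0 t k : (0 <= f t k)%E.
  by rewrite /f; case: ifP => // _; exact: cyl_weight_ge0.
have f_le t k : (f t k <= w t)%E.
  apply: le_trans (nneseries_lim_ge k.+1 _) => //.
  by rewrite big_nat_recr//= leeDr// sume_ge0.
have step t : (w t < cyl_weight R t)%E ->
    exists b, (w (rcons t b) < cyl_weight R (rcons t b))%E.
  move=> wt; apply: contrapT => /forallNP nb.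
  have {}nb b : (cyl_weight R (rcons t b) <= w (rcons t b))%E.
    by rewrite leNgt; apply/negP/nb.
  suff : (cyl_weight R t <= w t)%E by rewrite leNgt wt.
  apply: (@le_trans _ _ (w (rcons t false) + w (rcons t true))%E).
    apply: le_trans (leeD (nb false) (nb true)).
    rewrite /cyl_weight !size_rcons -EFinD lee_fin exprS -mulrDl.
    by rewrite [_ + _](_ : _ = 1) ?mul1r//; lra.
  rewrite /w -nneseriesD//; apply: lee_nneseries => k _.
    by move=> _; rewrite adde_ge0.
  rewrite /f; have h b : prefix (rcons t b) (s k) -> prefix t (s k).
    by apply: prefix_trans; rewrite -cats1 prefix_prefix.
  case: ifP => p0; case: ifP => p1; rewrite ?adde0 ?add0e ?(h _ p0) ?(h _ p1)//.
    move: p0 p1 => /prefixP[u0 ->]; rewrite -!cats1 -!catA/= => /prefixP[u1].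
    by rewrite -catA => /eqP; rewrite eqseq_cat// eqxx.
  by case: ifP => // _; exact: cyl_weight_ge0.
have {}step t : exists b, (w t < cyl_weight R t)%E ->
    (w (rcons t b) < cyl_weight R (rcons t b))%E.
  have [/step[b ?]|?] := pselect (w t < cyl_weight R t)%E; first by exists b.
  by exists false.
have [g gP] := choice step.
pose T := fix T n := if n is n'.+1 then rcons (T n') (g (T n')) else [::].
have T_lt n : (w (T n) < cyl_weight R (T n))%E.
  elim: n => [|n IH] /=; last exact: gP.
  by rewrite /cyl_weight/= expr0 /w /f; under eq_eseriesr do rewrite prefix0s.
pose y n := g (T n).
have Ty n : mkseq y n = T n by elim: n => // n IH; rewrite mkseqS IH.
(* The branch passes through some [s k] of the cover, whose own weight is a term of [w (s k)]. *)
have [k _ /cylinderP] := sT y I; rewrite Ty => Tk.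
have := T_lt (size (s k)); rewrite Tk ltNge => /negP; apply.
by apply: le_trans (f_le _ k); rewrite /f prefix_refl.
Qed.

(** A cover of total weight at most 1/2 cannot have a null complement, because the whole space has
    outer measure at least 1. *)
Lemma null_set_open_cover (R : realType) (X : set (nat -> bool)) :
  Defs.null_set R X ->
  exists2 s : nat -> seq bool, X `<=` \bigcup_k cylinder (s k) &
    coin_outer R (~` \bigcup_k cylinder (s k)) <> 0%E.
Proof.
move=> X0; have h : 0 < 2^-1 :> R by rewrite invr_gt0.
have [s Xs ws] := coin_outer_near X h; exists s => // C0.
have := coin_outer_setT R; rewrite leNgt => /negP; apply.
rewrite -(setUv (\bigcup_k cylinder (s k))).
apply: le_lt_trans (outer_measureU2 _ _ _) _; rewrite /= C0 adde0.
apply: le_lt_trans (@coin_outer_le_cover R _ s (@subset_refl _ _)) _.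
apply: le_lt_trans ws _; rewrite X0 add0e lte_fin; lra.
Qed.

Lemma coin_outer_le0 (R : realType) (X : set (nat -> bool)) :
  (forall n, (coin_outer R X <= (2^-1 ^+ n)%:E)%E) -> Defs.null_set R X.
Proof.
move=> X0; apply/eqP; rewrite eq_le coin_outer_ge0 andbT.
apply/lee_addgt0Pr => e /cyl_weight_small[n ne].
by rewrite add0e (le_trans (X0 n))// lee_fin ltW.
Qed.

(** * Reals cut into consecutive finite blocks *)

Definition block_start (L : nat -> nat) (k : nat) : nat := \sum_(i < k) L i.

Definition block (L : nat -> nat) (y : nat -> bool) (k : nat) :
    (L k).-tuple bool := [tuple y (block_start L k + i)%N | i < L k].

Lemma block_cylinder (L : nat -> nat) (y : nat -> bool) (k : nat) v
    (z : (L k).-tuple bool) :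
  size v = block_start L k -> cylinder (v ++ z) y -> block L y k = z.
Proof.
move=> va yz; apply: eq_from_tnth => i.
rewrite tnth_mktuple yz ?size_cat ?va ?size_tuple ?ltn_add2l//.
by rewrite nth_cat va ltnNge leq_addr/= addKn -tnth_nth.
Qed.

Lemma block_cantor_add (L : nat -> nat) (x y : nat -> bool) (k : nat) :
  block L (cantor_add x y) k = xor_tuple (block L x k) (block L y k).
Proof. by apply: eq_from_tnth => i; rewrite !tnth_mktuple. Qed.

Lemma block_startS (L : nat -> nat) (k : nat) :
  block_start L k.+1 = (block_start L k + L k)%N.
Proof. by rewrite /block_start big_ord_recr. Qed.

Lemma block_start_lt (L : nat -> nat) (k l : nat) : (k < l)%N ->
  (block_start L k + L k <= block_start L l)%N.
Proof.
elim: l => // l IH; rewrite ltnS leq_eqVlt block_startS => /orP[/eqP->//|/IH].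
by move=> h; rewrite (leq_trans h)// leq_addr.
Qed.

Lemma block_surj (L : nat -> nat) (u : forall k, (L k).-tuple bool) :
  exists y, forall k, block L y k = u k.
Proof.
exists (fun n => `[< exists k (i : 'I_(L k)),
  n = (block_start L k + i)%N /\ tnth (u k) i >]) => k.
apply: eq_from_tnth => i; rewrite tnth_mktuple.
apply/asboolP/idP => [[l [j [ij ujl]]]|ui]; last by exists k, i.
have kl : k = l.
  have := ltn_ord i; have := ltn_ord j.
  have [kl|lk|//] := ltngtP k l.
    by have := block_start_lt L kl; lia.
  by have := block_start_lt L lk; lia.
subst l; suff -> : i = j by [].
by apply/val_inj/(@addnI (block_start L k)).
Qed.

Definition limsup_blocks (L : nat -> nat)
    (J : forall k, {set (L k).-tuple bool}) : set (nat -> bool) :=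
  [set y | forall k0, exists2 k, (k0 <= k)%N & block L y k \in J k].

(** Borel-Cantelli: the bounds [2^-(k+1)] for the single blocks sum to [2^-n] over all [k >= n]. *)
Lemma limsup_blocks_null (R : realType) (L : nat -> nat)
    (J : forall k, {set (L k).-tuple bool}) :
  (forall k, (#|J k| * 2 ^ k.+1 <= 2 ^ L k)%N) ->
  Defs.null_set R (limsup_blocks J).
Proof.
move=> JL; pose D k := [set y | block L y k \in J k].
have D_le k : (coin_outer R (D k) <= (2^-1 ^+ k.+1)%:E)%E.
  rewrite -[D k]setIT (_ : setT = cylinder [::]); last by apply/seteqP; split.
  apply: le_trans (@coin_outer_block R (D k) [::] (block_start L k) (L k)
    (J k) 1 (2^-1 ^+ k.+1) _ _ _ _) _ => //.
  - have := JL k; rewrite -(ler_nat R) natrM !natrX => h.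
    by rewrite exprVn mulrC ler_pdivlMr// exprn_gt0.
  - move=> v va _ z; case: ifPn => zJ.
      apply: (@le_trans _ _ (coin_outer R (cylinder (v ++ z)))).
        by apply: le_coin_outer; exact: subIsetr.
      apply: le_trans (coin_outer_cylinder _ _) _.
      by rewrite /cyl_weight size_cat va size_tuple mul1r.
    rewrite (_ : _ `&` _ = set0) ?coin_outer_set0//.
    apply/seteqP; split=> // y [/= + yz]; move/negP: zJ => + yJ; apply.
    by rewrite -(block_cylinder va yz).
  - by rewrite mul1r expr0 mulr1.
apply: coin_outer_le0 => n.
apply: (@le_trans _ _ (coin_outer R (\bigcup_k D (k + n)%N))).
  apply: le_coin_outer => y /(_ n)[k nk yJ].
  by exists (k - n)%N => //; rewrite subnK.
apply: le_trans (outer_measure_sigma_subadditive _ _) _.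
apply: le_trans (@epsilon_trick0 R (2^-1 ^+ n) xpredT _); last exact: exprn_ge0.
apply: lee_nneseries => k _; first by move=> _; exact: coin_outer_ge0.
apply: le_trans (D_le _) _.
by rewrite -addSn exprD natrX -exprVn mulrC.
Qed.

(** * From null sets of translates to countably many predictors *)

Lemma prefix_chain (T : nat -> seq bool) :
  (forall n, prefix (T n) (T n.+1)) -> (forall n, (n <= size (T n))%N) ->
  exists y, forall n, cylinder (T n) y.
Proof.
move=> Tpre Tsize; exists (fun n => nth false (T n.+1) n) => n k kn.
have mono m l : (m <= l)%N -> prefix (T m) (T l).
  move=> ml; rewrite -(subnKC ml); elim: (l - m)%N => [|i IH].
    by rewrite addn0 prefix_refl.
  by rewrite addnS (prefix_trans IH).
have [/mono|/ltnW/mono] := leqP n k.+1.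
  by move=> /prefixP[u ->]; rewrite nth_cat kn.
by move=> /prefixP[u ->]; rewrite nth_cat Tsize.
Qed.

(** The predictors are indexed by basic clopen sets, hence countably many. For [t] with non-null
    trace on the closed set [K], and for large [k], [S t k] collects the [q] whose translate of
    [J k] is null inside that trace. *)
Lemma localization (R : realType) (Q : nat -> finType) :
  exists (code : (forall k, Q k) -> nat -> bool) (X : set (nat -> bool)),
    Defs.null_set R X /\
    forall F : set (forall k, Q k),
      Defs.null_set R (cantor_sumset [set code f | f in F] X) ->
      exists S : seq bool -> forall k, {set Q k},
        (forall t k, (#|S t k| <= 2 ^ k.+1)%N) /\
        forall f, F f -> exists t k0, forall k, (k0 <= k)%N -> f k \in S t k.
Proof.
have hL k := cid (independent_translates (Q k) k.+1).
pose L k := sval (hL k).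
have he k := cid (svalP (hL k)).
pose e k := sval (he k).
have hJ k := cid (svalP (he k)).
pose J k : {set (L k).-tuple bool} := sval (hJ k).
have LJe k := svalP (hJ k).
have [code codeP] := choice (fun f : forall k, Q k =>
  block_surj (fun k => e k (f k))).
exists code, (limsup_blocks J).
split; first by apply: limsup_blocks_null => k; have [] := LJe k.
move=> F /null_set_open_cover[s Fs U0].
set U := \bigcup_k cylinder (s k) in Fs U0.
pose good t := coin_outer R (~` U `&` cylinder t) <> 0%E.
(* The condition is vacuous when [t] reaches beyond the start of block [k], so only large [k] carry
   information. *)
pose S0 t k : {set Q k} := [set q | `[< forall v (z : (L k).-tuple bool),
  size v = block_start L k -> prefix t v -> good (v ++ z) ->
  xor_tuple z (e k q) \notin J k >]]%SET.
have start_ge k : (k <= block_start L k)%N.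
  rewrite /block_start -[leqLHS]muln1 -{1}(card_ord k) -sum_nat_const.
  by apply: leq_sum => i _; have [iL _ _] := LJe i; exact: leq_trans iL.
have good_few t : good t ->
    exists k0, forall k, (k0 <= k)%N -> (#|S0 t k| <= 2 ^ k.+1)%N.
  move=> gt; apply: contrapT => /forallNP many; apply: gt.
  have {}many k0 : exists2 k, (k0 <= k)%N & (2 ^ k.+1 <= #|S0 t k|)%N.
    apply: contrapT => no; apply: (many k0) => k kk0.
    by rewrite leqNgt; apply/negP => /ltnW ?; apply: no; exists k.
  (* Here [r] counts halvings: a block past [t'] with at least [2^(k+1)] members in [S0 t k] leaves
     at most half of the [z] non-null, and the induction hypothesis bounds each of these. *)
  suff decay r t' : prefix t t' -> (coin_outer R (~` U `&` cylinder t') <=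
      (2^-1 ^+ r * 2^-1 ^+ size t')%:E)%E.
    apply: coin_outer_le0 => n; apply: le_trans (decay n _ (prefix_refl _)) _.
    by rewrite lee_fin ler_piMr ?exprn_ge0// exprn_ile1// invf_le1// ler1n.
  elim: r t' => [|r IH] t' tt'.
    rewrite expr0 mul1r; apply: le_trans (coin_outer_cylinder _ _).
    by apply: le_coin_outer; exact: subIsetr.
  (* Every block has at least one bit, so block [k >= size t'] starts no earlier than the end of
     [t']. *)
  have [k tk Sk] := many (size t'); have [kL _ /(_ _ Sk) SJ] := LJe k.
  rewrite exprSr; apply: (coin_outer_block (leq_trans tk (start_ge k)) _ _ _).
  - exact: exprn_ge0.
  - by rewrite mulrC ler_pdivlMr// -natrX -natrM ler_nat; exact: SJ.
  - move=> v va t'v z; have tv := prefix_trans tt' t'v; case: ifPn => zG.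
      have := IH (v ++ z) (prefix_trans tv (prefix_prefix _ _)).
      by rewrite size_cat va size_tuple.
    move: zG; rewrite inE negb_forall => /existsP[q].
    rewrite negb_imply negbK => /andP[]; rewrite inE => /asboolP qS qJ.
    suff -> : coin_outer R (~` U `&` cylinder (v ++ z)) = 0%E by [].
    apply: contrapT => vz; have := qS v z va tv vz; by rewrite qJ.
(* The default empty set secures the size bound everywhere; for good [t] it occurs at finitely many
   [k] only. *)
pose S t k := if (#|S0 t k| <= 2 ^ k.+1)%N then S0 t k else finset.set0.
exists S; split=> [t k|f Ff].
  by rewrite /S; case: ifP => // _; rewrite cards0.
suff [t gt [k0 fS0]] : exists2 t, good t &
    exists k0, forall k, (k0 <= k)%N -> f k \in S0 t k.
  have [k1 few] := good_few _ gt; exists t, (maxn k0 k1) => k.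
  by rewrite geq_max => /andP[/fS0 fk /few Sk]; rewrite /S Sk.
(* Baire argument: if no good [t] captures [f], a chain of good strings is built that puts
   infinitely many blocks of [y] into the translates of [J k]. Its limit [y] then lies in the
   translate of [X] by [code f], hence in [U], so some string of the chain has its cylinder inside
   [U] and is not good. *)
apply: contrapT => nocapture.
have step t n : exists t', good t -> [/\ prefix t t', good t' &
    exists k v (z : (L k).-tuple bool), [/\ (n <= k)%N, t' = v ++ z,
      size v = block_start L k & xor_tuple z (e k (f k)) \in J k]].
  have [gt|] := pselect (good t); last by exists [::].
  apply: contrapT => no; apply: nocapture; exists t => //.
  exists n => k nk; rewrite inE; apply/asboolP => v z va tv vz.
  apply/negP => zJ; apply: no; exists (v ++ z) => _; split => //.
    exact: prefix_trans tv (prefix_prefix _ _).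
  by exists k, v, z.
have {}step p : exists t', good p.1 -> [/\ prefix p.1 t', good t' &
    exists k v (z : (L k).-tuple bool), [/\ (p.2 <= k)%N, t' = v ++ z,
      size v = block_start L k & xor_tuple z (e k (f k)) \in J k]].
  exact: step.
have [g gP] := choice step.
pose T := fix T n := if n is n'.+1 then g (T n', n') else [::].
have Tgood n : good (T n).
  elim: n => [|n IH]; last by have [] := gP (T n, n) IH.
  rewrite /good (_ : cylinder _ = setT) ?setIT//.
  by apply/seteqP; split.
have Tstep n := gP (T n, n) (Tgood n).
have Tsize n : (n <= size (T n))%N.
  case: n => // n; have [_ _ [k [v [z [nk Tvz va _]]]]] := Tstep n.
  rewrite [T _]Tvz size_cat va size_tuple -block_startS.
  exact: leq_ltn_trans nk (start_ge _).
have [y yT] : exists y, forall n, cylinder (T n) y.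
  by apply: prefix_chain => // n; have [] := Tstep n.
have [j _ yj] : U y.
  apply: Fs; exists (code f); first by exists f.
  exists (cantor_add y (code f)); last first.
    by apply/funext => n; rewrite /cantor_add; case: (y n); case: (code f n).
  move=> k0; have [_ _ [k [v [z [nk Tvz va zJ]]]]] := Tstep k0.
  exists k => //; rewrite block_cantor_add codeP.
  by rewrite (block_cylinder (z := z) va)// -Tvz; exact: (yT k0.+1).
apply: (Tgood (size (s j))); rewrite (_ : _ `&` _ = set0) ?coin_outer_set0//.
apply/seteqP; split=> // x [nUx xT]; apply: nUx; exists j => // k ks.
have kT := leq_trans ks (Tsize (size (s j))).
by rewrite xT// -yT// yj.
Qed.

(** * Fragments grouped into blocks, and the inequality *)

Lemma finite_set_nat_ub (A : set nat) :
  finite_set A -> exists b, A `<=` `I_b.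
Proof.
move=> /finite_seqP[s ->]; exists (\max_(i <- s) i.+1)%N => i /= si.
exact: (@leq_bigmax_seq _ s xpredT succn i si).
Qed.

(** The witness is the largest [k <= n] with [J k <= n], or 0 if there is none. It numbers the block
    of fragment [n]: the first clause gives gradualness there, the second makes block numbers
    diverge, the third makes each block finite. *)
Lemma diverging_index (J : nat -> nat) : exists kappa : nat -> nat,
  [/\ forall n, (J 0 <= n)%N -> (J (kappa n) <= n)%N,
      forall k n, (maxn k (J k) <= n)%N -> (k <= kappa n)%N &
      forall n, (n < maxn (kappa n).+1 (J (kappa n).+1))%N].
Proof.
pose kappa n := \max_(k < n.+1 | (J k <= n)%N) k.
have kappa_ge k n : (maxn k (J k) <= n)%N -> (k <= kappa n)%N.
  rewrite geq_max => /andP[kn Jn].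
  exact: (@leq_bigmax_cond _ (fun k : 'I_n.+1 => (J k <= n)%N) _
    (Ordinal (kn : k < n.+1)%N)).
exists kappa; split=> // [n J0n|n].
  rewrite /kappa (bigop.bigmax_eq_arg ord0)//.
  by case: arg_maxnP.
by rewrite ltnNge; apply/negP => /kappa_ge; rewrite ltnn.
Qed.

Lemma capture_bounded (R : realType) (I : set (set nat)) P
    (phi : nat -> set nat -> \bar R) (AA : set (set nat)) (m : nat) :
  fragmentation I P phi -> gradual P phi ->
  (forall (code : set nat -> nat -> bool) X, Defs.null_set R X ->
    Defs.null_set R (cantor_sumset [set code A | A in AA] X)) ->
  exists B : seq bool -> set nat, (forall t, I (B t)) /\
    forall A, AA A -> (forall n, (phi n (A `&` P n) <= m%:R%:E)%E) ->
      exists t, almost_subset A (B t).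
Proof.
move=> fragI [f fP] AAnull.
have eventually k : exists n, forall j, (n <= j)%N ->
    forall BB : set (set nat),
      (forall B, BB B -> B `<=` P j) -> (BB #<= `I_(2 ^ k.+1))%card ->
      (forall B, BB B -> (phi j B <= m%:R%:E)%E) ->
      (phi j (\bigcup_(B in BB) B) <= (f m)%:R%:E)%E.
  by have [n _ nP] := fP m (2 ^ k.+1)%N; exists n => j /nP.
have [J JP] := choice eventually.
have [kappa [kappaJ kappa_ge kappa_lt]] := diverging_index J.
have [b bP] : exists b : nat -> nat, forall n, P n `<=` `I_(b (kappa n)).
  have bounded k : exists b,
      \bigcup_(n in `I_(maxn k.+1 (J k.+1))) P n `<=` `I_b.
    apply: finite_set_nat_ub; apply: bigcup_finite => // n _.
    exact: frag_finite fragI n.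
  have [b bP] := choice bounded.
  by exists b => n x Pnx; apply: bP; exists n => //; exact: kappa_lt.
(* All of [A] below [b k] is recorded, which covers every fragment of block [k] at once. *)
pose trace (A : set nat) k : {set 'I_(b k)} :=
  [set i : 'I_(b k) | `[< A i >]]%SET.
pose untrace k (q : {set 'I_(b k)}) : set nat :=
  [set x | exists2 i : 'I_(b k), i \in q & val i = x].
have [code [X [X0 XP]]] := localization R (fun k => {set 'I_(b k)} : finType).
have [|S [Ssmall SP]] := XP [set trace A | A in AA].
  by rewrite image_comp; exact: (AAnull (code \o trace) X X0).
(* Candidates of submeasure above [m] on [P n] are discarded, since gradualness says nothing about
   them. Below [J 0] the block number is only a default, so those fragments are left out. *)
pose B t := [set x | exists n, [/\ P n x, (J 0 <= n)%N &
  exists q, [/\ q \in S t (kappa n), untrace _ q x &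
    (phi n (untrace _ q `&` P n) <= m%:R%:E)%E]]].
have [[Pcover Ptriv _] Pfin Psub IE] := fragI.
exists B; split=> [t|A AAA Am].
  apply/IE; apply: (@le_lt_trans _ _ (f m)%:R%:E); last exact: ltry.
  apply: ge_ereal_sup => _ [n _ <-].
  have [J0n|nJ0] := leqP (J 0) n; last first.
    rewrite (_ : _ `&` _ = set0).
      by rewrite (submeasure0 (Psub n)) lee_fin.
    apply/seteqP; split=> // x [[l [Plx J0l _]] Pnx].
    have nl : n = l by apply: Ptriv => //; exists x.
    by rewrite -nl leqNgt nJ0 in J0l.
  pose BB := [set C | exists q, [/\ q \in S t (kappa n),
    C = untrace _ q `&` P n & (phi n C <= m%:R%:E)%E]].
  rewrite (_ : B t `&` P n = \bigcup_(C in BB) C); last first.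
    apply/seteqP; split=> x.
      move=> [[l [Plx _ [q [qS qx qm]]]] Pnx].
      have nl : n = l by apply: Ptriv => //; exists x.
      by subst l; exists (untrace _ q `&` P n) => //; exists q.
    move=> [_ [q [qS -> qm]] [qx Pnx]]; split => //.
    by exists n; split => //; exists q.
  apply: (JP (kappa n)); first exact: kappaJ.
  - by move=> _ [q [_ -> _]]; exact: subIsetr.
  - apply: card_le_trans (card_image_le (fun i =>
      untrace _ (nth finset.set0 (enum (S t (kappa n))) i) `&` P n) _).
    apply: subset_card_le => _ [q [qS -> _]].
    rewrite -mem_enum in qS; exists (index q (enum (S t (kappa n)))).
      by rewrite /= (leq_trans _ (Ssmall t _))// cardE index_mem.
    by rewrite nth_index.
  - by move=> C [q []].
have [|t [k0 tP]] := SP (trace A); first by exists A.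
(* From [N] on, the block number is at least [k0], so the trace of [A] is among the candidates; only
   finitely many finite fragments remain. *)
exists t; pose N := maxn (J 0) (maxn k0 (J k0)).
apply: (@sub_finite_set _ _ (\bigcup_(n in `I_N) P n)).
  move=> x [Ax nBx]; have [n _ Pnx] : cover setT P x by rewrite Pcover.
  exists n => //=; rewrite ltnNge; apply/negP => Nn; apply: nBx.
  move: Nn; rewrite geq_max => /andP[J0n /kappa_ge/tP AS].
  have tr : untrace _ (trace A (kappa n)) `&` P n = A `&` P n.
    apply/seteqP; split=> y [].
      by move=> [i +] <- ?; rewrite inE => /asboolP.
    move=> Ay Pny; split => //; exists (Ordinal (bP n y Pny)) => //.
    by rewrite inE; apply/asboolP.
  exists n; split => //; exists (trace A (kappa n)); rewrite tr; split => //.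
  by have [] : (untrace _ (trace A (kappa n)) `&` P n) x by rewrite tr.
by apply: bigcup_finite => // n _; exact: Pfin.
Qed.

Theorem theorem3p16 (R : realType) (I : set (set nat)) :
  omega_ideal I -> gradually_fragmented R I ->
  cardinal_le (add_t_null R) (add_star_omega I).
Proof.
move=> Iideal [P [phi [fragI grad]]]; apply/cardinal_le_minP => AA [AAI AAW].
apply: contrapT => small.
(* An image of [AA] is no larger than [AA], so by [small] it cannot witness the failure of
   transitive additivity. *)
have AAnull (code : set nat -> nat -> bool) X : Defs.null_set R X ->
    Defs.null_set R (cantor_sumset [set code A | A in AA] X).
  move=> X0; apply: contrapT => nnull; apply: small.
  by exists [set code A | A in AA]; [exists X|exact: card_image_le].
have [B BP] :=
  choice (fun m => @capture_bounded R I P phi AA m fragI grad AAnull).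
(* The initial segments are added only to make the countable family infinite. *)
pose h (p : nat * seq bool + nat) : set nat :=
  match p with inl mt => B mt.1 mt.2 | inr n => `I_n end.
have [||A AAA AB] := AAW (range h).
- move=> _ [[[m t]|n] _ <-]; first by have [/(_ t)] := BP m.
  exact: (ideal_fin Iideal (finite_II n)).
- apply: eq_card_nat.
    by apply: sub_countable (card_image_le _ _) _; exact: countableP.
  apply/infiniteP; apply: (@card_le_trans _ _ _ (range (fun n => `I_n))).
    have /card_eqPle[] // : (range (fun n => `I_n) #= [set: nat])%card.
    apply: inj_card_eq => m n _ _ mn; apply/eqP.
    by rewrite eqn_leq -!card_le_II mn card_lexx.
  by apply: subset_card_le => _ [n _ <-]; exists (inr n).
have supA : (ereal_sup (range (fun n => phi n (A `&` P n))) < +oo)%E.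
  by apply/(frag_idealE fragI); exact: AAI.
have [m Am] : exists m, forall n, (phi n (A `&` P n) <= m%:R%:E)%E.
  have : forall n, (phi n (A `&` P n) <=
      ereal_sup (range (fun n => phi n (A `&` P n))))%E.
    by move=> n; apply: ereal_sup_ubound; exists n.
  move: supA; case: (ereal_sup _) => [r||] // _ Ar.
    exists (Num.bound `|r|) => n; apply: le_trans (Ar n) _.
    by rewrite lee_fin (le_trans (ler_norm _))// ltW// archi_boundP.
  by exists 0%N => n; exact: le_trans (Ar n) (leNye _).
have [_ /(_ A AAA Am)[t At]] := BP m.
by apply: (AB (B m t)) => //; exists (inl (m, t)).
Qed.
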